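(* For every positive integer $n$, $$\mathrm{SgnDAltrun}_{n,-,a}(p,q)=\begin{cases}(1-q)(1-pq)^{k-1}& n=2k,\\ (1-pq)^k & n=2k+1,\end{cases}\qquad \mathrm{SgnDAltrun}_{n,-,d}(p,q)=\begin{cases}(1-p)(1-pq)^{k-1}& n=2k,\\ 0 & n\text{ odd}.\end{cases}$$
   Context: $\mathfrak{B}_n$ is the group of signed permutations in window notation $\pi=\pi_1\cdots\pi_n$ ($\pi_i\in\{\pm1,\dots,\pm n\}$, $\{|\pi_i|\}=[n]$), and $\mathfrak{D}_n\subseteq\mathfrak{B}_n$ is the subset of those with an even number of negative entries. For $\pi\in\mathfrak{B}_n$, $\mathrm{inv}_D(\pi)=|\{1\le i<j\le n:\pi_i>\pi_j\}|+|\{1\le i<j\le n:-\pi_i>\pi_j\}|$ (usual order on $\mathbb{Z}$). Set $\pi_0=0$; $\mathrm{pk}_D(\pi)$ (resp. $\mathrm{val}_D(\pi)$) is the number of $i\in\{1,\dots,n-1\}$ with $\pi_{i-1}<\pi_i>\pi_{i+1}$ (resp. $\pi_{i-1}>\pi_i<\pi_{i+1}$). Let $\mathfrak{D}_{n,-,a}=\{\pi\in\mathfrak{D}_n:\pi_{n-1}<\pi_n\}$, $\mathfrak{D}_{n,-,d}=\{\pi\in\mathfrak{D}_n:\pi_{n-1}>\pi_n\}$, and $\mathrm{SgnDAltrun}_{n,-,a}(p,q)=\sum_{\pi\in\mathfrak{D}_{n,-,a}}(-1)^{\mathrm{inv}_D(\pi)}p^{\mathrm{pk}_D(\pi)}q^{\mathrm{val}_D(\pi)}$,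 and similarly $\mathrm{SgnDAltrun}_{n,-,d}$ over $\mathfrak{D}_{n,-,d}$. *)

(* Defs.v *)
From mathcomp Require Import all_boot all_order all_fingroup all_algebra.

Set Implicit Arguments.
Unset Strict Implicit.
Unset Printing Implicit Defensive.

Import Order.TTheory GRing.Theory Num.Theory.

Local Open Scope ring_scope.

(* Window notation: the pair (s, e) stands for the signed permutation w with
   w_(i+1) = (-1)^(e i) * (s i + 1), as 'I_n is {0, ..., n-1}.  Lemmas
   letter_inj and windowP check that these are exactly the windows w_1 ... w_n
   with {|w_1|, ..., |w_n|} = {1, ..., n}. *)
Notation signed_perm n := ({perm 'I_n} * {ffun 'I_n -> bool})%type.

(* Letters are numbered from 1, with w_0 = 0; indices above n are junk. *)
Definition letter (n : nat) (w : signed_perm n) (i : nat) : int :=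
  if i is j.+1 then
    if insub j is Some k then (-1) ^+ w.2 k * (w.1 k).+1%:Z else 0
  else 0.

Definition evenly_signed (n : nat) : {set signed_perm n} :=
  [set w | ~~ odd #|[set i : 'I_n | letter w i.+1 < 0]|].

Definition inv_D (n : nat) (w : signed_perm n) : nat :=
  #|[set ij : 'I_n.+1 * 'I_n.+1 |
      (1 <= ij.1 < ij.2)%N && (letter w ij.1 > letter w ij.2)]| +
  #|[set ij : 'I_n.+1 * 'I_n.+1 |
      (1 <= ij.1 < ij.2)%N && (- letter w ij.1 > letter w ij.2)]|.

Definition pk_D (n : nat) (w : signed_perm n) : nat :=
  #|[set i : 'I_n | [&& (1 <= i)%N, letter w i.-1 < letter w i
                      & letter w i > letter w i.+1]]|.

Definition val_D (n : nat) (w : signed_perm n) : nat :=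
  #|[set i : 'I_n | [&& (1 <= i)%N, letter w i.-1 > letter w i
                      & letter w i < letter w i.+1]]|.

Definition evenly_signed_a (n : nat) : {set signed_perm n} :=
  [set w in evenly_signed n | letter w n.-1 < letter w n].

Definition evenly_signed_d (n : nat) : {set signed_perm n} :=
  [set w in evenly_signed n | letter w n.-1 > letter w n].

(* A bivariate polynomial with integer coefficients, given through its values
   at arbitrary points p, q of arbitrary commutative rings; the polynomial
   itself is the value at the two variables of a polynomial ring. *)
Definition SgnDAltrun_a (R : comNzRingType) (n : nat) (p q : R) : R :=
  \sum_(w in evenly_signed_a n) (-1) ^+ inv_D w * p ^+ pk_D w * q ^+ val_D w.

Definition SgnDAltrun_d (R : comNzRingType) (n : nat) (p q : R) : R :=
  \sum_(w in evenly_signed_d n) (-1) ^+ inv_D w * p ^+ pk_D w * q ^+ val_D w.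

Lemma letterS (n : nat) (w : signed_perm n) (i : 'I_n) :
  letter w i.+1 = (-1) ^+ w.2 i * (w.1 i).+1%:Z.
Proof. by rewrite /letter valK. Qed.

Lemma absz_letterS (n : nat) (w : signed_perm n) (i : 'I_n) :
  `|letter w i.+1|%N = (w.1 i).+1.
Proof. by rewrite letterS abszMsign. Qed.

Lemma letterS_lt0 (n : nat) (w : signed_perm n) (i : 'I_n) :
  (letter w i.+1 < 0) = w.2 i.
Proof. by rewrite letterS; case: (w.2 i). Qed.

Lemma letter_inj (n : nat) (v w : signed_perm n) :
  (forall i : 'I_n, letter v i.+1 = letter w i.+1) -> v = w.
Proof.
case: v w => [s e] [t f] eq_vw; congr pair.
  apply/permP => i; apply/val_inj/succn_inj.
  by have := absz_letterS (s, e) i; rewrite eq_vw absz_letterS /= => ->.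
by apply/ffunP => i; have := letterS_lt0 (s, e) i; rewrite eq_vw letterS_lt0.
Qed.

Lemma windowP (n : nat) (u : 'I_n -> int) :
  (forall k, (exists i, `|u i|%N = k) <-> (1 <= k <= n)%N) <->
  exists w : signed_perm n, forall i : 'I_n, letter w i.+1 = u i.
Proof.
split=> [uP | [w wE] k]; last first.
  split=> [[i <-] | /andP[]]; first by rewrite -wE absz_letterS /=.
  case: k => // k _ ltkn; exists ((w.1)^-1%g (Ordinal ltkn)).
  by rewrite -wE absz_letterS permKV.
have u_bnd i : (1 <= `|u i| <= n)%N by apply/uP; exists i.
have lt_u i : (`|u i|.-1 < n)%N by case/andP: (u_bnd i); case: absz.
pose f i := Ordinal (lt_u i).
have f_surj k : exists i, f i == k.
  have [_ /(_ (ltn_ord k))[i ui]] := uP k.+1.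
  by exists i; apply/eqP/val_inj; rewrite /= ui.
have f_inj : injective f.
  pose g k := xchoose (f_surj k).
  have gK : cancel g f by move=> k; apply/eqP/(xchooseP (f_surj k)).
  exact: can_inj (canF_sym gK).
exists (perm f_inj, [ffun i => u i < 0]) => i.
rewrite letterS /= ffunE permE /= prednK; last by case/andP: (u_bnd i).
by rewrite abszE -realEsign // num_real.
Qed.

(* Main.v *)
(* Modulo 2, inv_D is the number of inversions of the underlying permutation, so
   (-1)^inv_D changes sign when the two letters of largest absolute value
   exchange their absolute values.  This exchange keeps the positions of the
   ascents, unless the two letters are adjacent and of the same sign; in that
   case, if the pair is not at the end of the word, it sits between an ascent
   and a descent, and the numbers of peaks and valleys do not change either.
   So only the words ending in +-{n-1, n}, with a common sign, survive.
   Deleting these two letters expresses the sums for n through those for n-2: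
   for n > 2, both get multiplied by 1 - pq. *)

Require Import Defs.
From mathcomp Require Import all_boot all_order all_fingroup all_algebra.
From mathcomp Require Import zify ring.

Set Implicit Arguments.
Unset Strict Implicit.
Unset Printing Implicit Defensive.

Import Order.TTheory GRing.Theory Num.Theory.

Local Open Scope ring_scope.

(** * Parity of [inv_D] *)

Lemma card_ord_pairs n (r : nat -> nat -> bool) :
  #|[set ij : 'I_n.+1 * 'I_n.+1 | (1 <= ij.1 < ij.2)%N && r ij.1 ij.2]| =
  (\sum_(i < n) \sum_(j < n | (i < j)%N) r i.+1 j.+1)%N.
Proof.
rewrite -sum1_card (eq_bigl _ _ (in_set _)).
rewrite big_mkcond -(pair_bigA _ (fun i j : 'I_n.+1 =>
  if (1 <= i < j)%N && r i j then 1 else 0)%N) /= big_ord_recl big1 ?add0n //=.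
apply: eq_bigr => i _; rewrite big_ord_recl add0n [RHS]big_mkcond.
by apply: eq_bigr => j _; rewrite !lift0 ltnS [bump 0 i]lift0;
  case: ltnP; case: r.
Qed.

Lemma sgr_prod (D : realDomainType) (I : Type) (r : seq I) (P : pred I)
    (F : I -> D) :
  Num.sg (\prod_(i <- r | P i) F i) = \prod_(i <- r | P i) Num.sg (F i).
Proof. exact: (big_morph _ (@sgrM D) (sgr1 D)). Qed.

(* Compare the Vandermonde determinants at (s 0, ..., s (n-1)) and at
   (0, ..., n-1): they differ by a permutation of the columns. *)
Lemma prod_sgr_perm n (s : 'S_n) :
  \prod_(i < n) \prod_(j < n | (i < j)%N) Num.sg ((s j)%:Z - (s i)%:Z) =
    (-1) ^+ s.
Proof.
pose a := \row_(j < n) (j%:Z); pose b := \row_(j < n) ((s j)%:Z).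
have eq_b : Vandermonde n b = col_perm s (Vandermonde n a).
  by apply/matrixP => i j; rewrite !mxE.
have := congr1 (fun M => Num.sg (\det M)) eq_b.
rewrite col_permE det_mulmx det_perm sgrM !det_Vandermonde sgrX.
rewrite !sgr_prod; under eq_bigr => i _ do rewrite sgr_prod.
under eq_bigr => i _ do under eq_bigr => j _ do rewrite !mxE.
(* At the points 0, ..., n-1 every Vandermonde factor is positive, so only the sign of the column
   permutation is left. *)
move=> ->; rewrite big1 ?mul1r => [|i _]; first by rewrite sgrN sgr1 odd_permV.
rewrite sgr_prod big1 // => j lt_ij; rewrite !mxE gtr0_sg //; lia.
Qed.

(** If |a| < |b|, the sign of [b] makes both tests hold or both fail; if |a| > |b|, exactly one
    holds. Modulo 2 the pair thus counts as an inversion of the absolute values. *)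
Lemma sign_inversions (a b : int) : `|a|%N != `|b|%N ->
  (-1) ^+ ((a > b)%R + (- a > b)%R) = Num.sg ((absz b)%:Z - (absz a)%:Z) :> int.
Proof.
move=> neq_ab; have [lt_ab|lt_ba|eq_ab] := ltngtP `|a|%N `|b|%N.
- rewrite gtr0_sg; last lia.
  have [b_gt0|b_le0] := ltrP 0 b.
    have -> : (b < a) = false by lia.
    by have -> : (b < - a) = false by lia.
  have -> : (b < a) = true by lia.
  by have -> : (b < - a) = true by lia.
- rewrite ltr0_sg; last lia.
  have [a_gt0|a_le0] := ltrP 0 a.
    have -> : (b < a) = true by lia.
    by have -> : (b < - a) = false by lia.
  have -> : (b < a) = false by lia.
  by have -> : (b < - a) = true by lia.
- by rewrite eq_ab eqxx in neq_ab.
Qed.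

Lemma odd_inv_D n (w : signed_perm n) : odd (inv_D w) = w.1.
Proof.
apply: (@signr_inj int); rewrite signr_odd /inv_D.
rewrite (card_ord_pairs n (fun i j => letter w j < letter w i)).
rewrite (card_ord_pairs n (fun i j => letter w j < - letter w i)).
rewrite -big_split /= -prodrXr -prod_sgr_perm; apply: eq_bigr => i _.
rewrite -big_split /= -prodrXr; apply: eq_bigr => j lt_ij.
rewrite sign_inversions !absz_letterS; first by congr Num.sg; lia.
by rewrite eqSS (inj_eq val_inj) (inj_eq perm_inj) -val_eqE neq_ltn lt_ij.
Qed.

(** * Steps of a word, and the weight as a product over turns *)

Definition up n (w : signed_perm n) i : bool := letter w i < letter w i.+1.

Lemma letter_neq n (w : signed_perm n) i :
  (i < n)%N -> letter w i != letter w i.+1.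
Proof.
move=> lt_in; apply/eqP => /(congr1 absz).
rewrite (absz_letterS w (Ordinal lt_in)).
case: i lt_in => [|i] lt_in //; rewrite (absz_letterS w (Ordinal (ltnW lt_in))).
by move=> [/val_inj/perm_inj/(congr1 val)/= /eqP]; rewrite ltn_eqF.
Qed.

Lemma down_up n (w : signed_perm n) i :
  (i < n)%N -> (letter w i.+1 < letter w i) = ~~ up w i.
Proof.
move=> lt_in; rewrite /up -leNgt le_eqVlt eq_sym.
by rewrite (negPf (letter_neq w lt_in)).
Qed.

(** Two consecutive steps, [true] being an ascent: ascent then descent is a peak, descent then
    ascent a valley. *)
Definition turn (R : comNzRingType) (p q : R) (a b : bool) : R :=
  if a == b then 1 else if a then p else q.

(** Here [n] counts turns, so [u] is read at 0, ..., [n]; a nonempty word of m letters has m - 1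
    turns. *)
Definition wt (R : comNzRingType) (p q : R) (u : nat -> bool) n : R :=
  \prod_(i < n) turn p q (u i) (u i.+1).

Lemma card_inner n (P : pred nat) :
  #|[set i : 'I_n | (1 <= i)%N && P i]| = (\sum_(i < n.-1) P i.+1)%N.
Proof.
rewrite -sum1_card (eq_bigl _ _ (in_set _)) big_mkcond.
case: n => [|n]; first by rewrite !big_ord0.
rewrite big_ord_recl /= add0n; apply: eq_bigr => i _.
by rewrite [bump 0 i]lift0; case: P.
Qed.

Lemma weightE (R : comNzRingType) (p q : R) n (w : signed_perm n) :
  (-1) ^+ inv_D w * p ^+ pk_D w * q ^+ val_D w =
    (-1) ^+ w.1 * wt p q (up w) n.-1.
Proof.
rewrite -signr_odd odd_inv_D -mulrA; congr (_ * _).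
rewrite /pk_D /val_D.
rewrite (card_inner n (fun i => (letter w i.-1 < letter w i) &&
  (letter w i.+1 < letter w i))).
rewrite (card_inner n (fun i => (letter w i < letter w i.-1) &&
  (letter w i < letter w i.+1))).
rewrite -!prodrXr -big_split; apply: eq_bigr => i _ /=.
(* Both steps at the inner position [i.+1] stay within the word, where adjacent letters differ and a
   step that is not an ascent is a descent. *)
have lt_in : (i.+1 < n)%N by case: i => i /=; case: (n).
rewrite !down_up ?(ltnW lt_in) // /turn.
rewrite -!/(up w i) -!/(up w i.+1).
by case: (up w i); case: (up w i.+1); rewrite /= ?expr0 ?expr1 ?mulr1 ?mul1r.
Qed.

(** * Absolute values of letters, and the exchange of the two largest *)

Lemma absz_letter_le n (w : signed_perm n) i : (`|letter w i| <= n)%N.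
Proof.
case: i => [|i] //; case: (ltnP i n) => [lt_in | le_ni].
  by rewrite (absz_letterS w (Ordinal lt_in)) ltn_ord.
by rewrite /letter insubF // ltnNge le_ni.
Qed.

Lemma absz_letter_inj n (w : signed_perm n) i j : (i <= n)%N -> (j <= n)%N ->
  `|letter w i|%N = `|letter w j|%N -> i = j.
Proof.
case: i j => [|i] [|j] // lt_in lt_jn.
- by rewrite (absz_letterS w (Ordinal lt_jn)).
- by rewrite (absz_letterS w (Ordinal lt_in)).
rewrite (absz_letterS w (Ordinal lt_in)) (absz_letterS w (Ordinal lt_jn)).
by move=> [/val_inj/perm_inj/(congr1 val)/= ->].
Qed.

(** The form as a lift lets [liftK] and [lift_perm_lift] compute at this index. *)
Definition penult n : 'I_n.+2 := lift ord_max ord_max.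

Lemma val_penult n : penult n = n :> nat.
Proof. exact: lift_max. Qed.

Lemma penult_neq_max n : penult n != ord_max.
Proof. by rewrite eq_sym neq_lift. Qed.

(* Exchanges the absolute values n.+1 and n.+2 and keeps the signs in place. *)
Definition swap_top n (w : signed_perm n.+2) : signed_perm n.+2 :=
  ((w.1 * tperm (penult n) ord_max)%g, w.2).

Lemma swap_topK n : involutive (@swap_top n).
Proof. by move=> [s e]; rewrite /swap_top /= -mulgA tperm2 mulg1. Qed.

Lemma odd_swap_top n (w : signed_perm n.+2) : (swap_top w).1 = ~~ w.1 :> bool.
Proof. by rewrite odd_permM odd_tperm penult_neq_max addbT. Qed.

Lemma evenly_signedE n (w : signed_perm n) :
  (w \in evenly_signed n) = ~~ \big[addb/false]_(i < n) w.2 i.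
Proof.
rewrite inE -sum1_card (eq_bigl _ _ (in_set _)) big_mkcond.
rewrite (big_morph odd oddD (erefl _)); congr (~~ _).
by apply: eq_bigr => i _; rewrite letterS_lt0; case: (w.2 i).
Qed.

Lemma swap_top_evenly_signed n (w : signed_perm n.+2) :
  (swap_top w \in evenly_signed _) = (w \in evenly_signed _).
Proof. by rewrite !evenly_signedE. Qed.

(** This case list reduces every comparison of letters before and after the exchange to linear
    arithmetic. *)
Lemma letter_swap_top n (w : signed_perm n.+2) i :
  let x := letter w i in let y := letter (swap_top w) i in
  [\/ (`|x| <= n)%N /\ y = x, x = n.+1%:Z /\ y = n.+2%:Z,
      x = n.+2%:Z /\ y = n.+1%:Z
    | x = - n.+1%:Z /\ y = - n.+2%:Z \/ x = - n.+2%:Z /\ y = - n.+1%:Z].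
Proof.
case: i => [|i] /=; first by constructor 1.
case: insubP => [k _ _|_]; last by constructor 1.
rewrite permM; case: tpermP => [->|->|/eqP neq_p /eqP neq_m].
- rewrite val_penult; case: (w.2 k); [constructor 4; left | constructor 2];
    by rewrite ?expr1 ?expr0 ?mulN1r ?mul1r.
- rewrite val_penult.
  case: (w.2 k); [constructor 4; right | constructor 3];
    by rewrite ?expr1 ?expr0 ?mulN1r ?mul1r.
constructor 1; split=> //; rewrite abszMsign /=.
move: neq_p neq_m; rewrite -!val_eqE [val (penult n)]val_penult /=.
by have := ltn_ord (w.1 k); lia.
Qed.

(* Since letter 0 is 0, this forces i > 0: the letters i and i.+1 then have
   absolute values n.+1 and n.+2, in some order, and the same sign. *)
Definition top_pair n (w : signed_perm n.+2) i : bool :=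
  [&& (n < `|letter w i|)%N, (n < `|letter w i.+1|)%N
    & (letter w i < 0) == (letter w i.+1 < 0)].

Lemma top_pair_swap n (w : signed_perm n.+2) i :
  top_pair (swap_top w) i = top_pair w i.
Proof.
rewrite /top_pair; have := letter_swap_top w i.
have /= := letter_swap_top w i.+1.
case=> [[? ->]|[-> ->]|[-> ->]|[[-> ->]|[-> ->]]];
  by case=> [[? ->]|[-> ->]|[-> ->]|[[-> ->]|[-> ->]]]; lia.
Qed.

(** Against a letter of absolute value at most [n], the values [n.+1] and [n.+2] compare alike, and
    opposite signs settle a comparison alone. Only a top pair is decided by which of the two values
    comes first. *)
Lemma up_swap_top_addb n (w : signed_perm n.+2) i : (i < n.+2)%N ->
  up (swap_top w) i = top_pair w i (+) up w i.
Proof.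
move=> lt_in.
have neq_i : `|letter w i|%N != `|letter w i.+1|%N.
  by apply: contra_neq (@absz_letter_inj _ w i i.+1 (ltnW lt_in) lt_in) _; lia.
rewrite /top_pair /up; move: neq_i; have := letter_swap_top w i.
have /= := letter_swap_top w i.+1.
case=> [[? ->]|[-> ->]|[-> ->]|[[-> ->]|[-> ->]]];
  by case=> [[? ->]|[-> ->]|[-> ->]|[[-> ->]|[-> ->]]]; lia.
Qed.

Lemma up_swap_top n (w : signed_perm n.+2) i : (i < n.+2)%N ->
  ~~ top_pair w i -> up (swap_top w) i = up w i.
Proof. by move=> lt_in /negPf ntop; rewrite up_swap_top_addb // ntop. Qed.

Lemma up_swap_top_pair n (w : signed_perm n.+2) i : (i < n.+2)%N ->
  top_pair w i -> up (swap_top w) i = ~~ up w i.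
Proof. by move=> lt_in top_i; rewrite up_swap_top_addb // top_i. Qed.

(** Two top pairs at i < j would put absolute values above [n] at the three positions i, i+1, j+1,
    but only two such values exist. *)
Lemma top_pair_uniq n (w : signed_perm n.+2) i j : (i < n.+2)%N ->
  (j < n.+2)%N -> top_pair w i -> top_pair w j -> i = j.
Proof.
wlog lt_ij : i j / (i < j)%N.
  move=> IH lt_in lt_jn top_i top_j.
  have [lt_ij|lt_ji|//] := ltngtP i j; first exact: IH.
  by apply/esym/IH.
move=> lt_in lt_jn /and3P[gt_i gt_i1 _] /and3P[_ gt_j1 _].
have bnd k := absz_letter_le w k; have inj k l := @absz_letter_inj _ w k l.
move: (bnd i) (bnd i.+1) (bnd j.+1) (inj i i.+1) (inj i j.+1) (inj i.+1 j.+1).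
by lia.
Qed.

(** Both neighbours of the pair have absolute value at most [n], so they lie on the same side of it:
    below if the pair is positive, above if negative. *)
Lemma top_pair_outer n (w : signed_perm n.+2) t : (t < n)%N ->
  top_pair w t.+1 -> up w t = ~~ up w t.+2.
Proof.
move=> lt_tn /and3P[gt_1 gt_2 /eqP eq_sg]; rewrite /up.
have bnd k := absz_letter_le w k; have inj k l := @absz_letter_inj _ w k l.
move: (bnd t.+1) (bnd t.+2) (bnd t) (bnd t.+3).
move: (inj t t.+1) (inj t t.+2) (inj t.+1 t.+2) (inj t.+1 t.+3).
move: (inj t.+2 t.+3).
by lia.
Qed.

(** * Cancellation under the exchange *)

Section Weights.

Variables (R : comNzRingType) (p q : R).

(** The step at [t.+1] agrees with exactly one of its two opposite neighbours. One of the two turns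
    is then trivial, and the other is [p] or [q] according to [u t] alone. *)
Lemma wt_flip (u v : nat -> bool) m t : (t.+1 < m)%N ->
  (forall i, (i <= m)%N -> i != t.+1 -> u i = v i) -> u t = ~~ u t.+2 ->
  wt p q u m = wt p q v m.
Proof.
move=> lt_tm eq_uv ut; pose i1 : 'I_m := Ordinal lt_tm.
pose i0 : 'I_m := Ordinal (ltnW lt_tm).
have neq10 : i1 != i0 by rewrite -val_eqE /= gtn_eqF.
rewrite /wt (bigD1 i0) //= (bigD1 i1) //= [RHS](bigD1 i0) //=.
rewrite [in RHS](bigD1 i1) //= !mulrA; congr (_ * _).
  rewrite -(eq_uv t) -?(eq_uv t.+2) // ?ut; [|lia..].
  by rewrite /turn; case: (u t.+1) (v t.+1) (u t.+2) => [] [] [];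
     rewrite /= ?mulr1 ?mul1r.
apply: eq_bigr => i /andP[]; rewrite -!val_eqE /= => ne_i0 ne_i1.
by have lt_im := ltn_ord i; rewrite !eq_uv //; lia.
Qed.

Lemma wt_swap_top n (w : signed_perm n.+2) : ~~ top_pair w n.+1 ->
  wt p q (up (swap_top w)) n.+1 = wt p q (up w) n.+1.
Proof.
move=> ntop.
have [/existsP[i top_i]|] := boolP [exists i : 'I_n.+2, top_pair w i].
  case: i top_i => [[|t] lt_t] /= top_t; first by [].
  have lt_tn : (t < n)%N.
    by have: t != n; [apply: contraNneq ntop => eq_tn; rewrite -{2}eq_tn | lia].
  apply/esym/(@wt_flip _ _ _ t) => //; last exact: top_pair_outer.
  move=> i le_in ne_it; rewrite up_swap_top //.
  by apply: contraNN ne_it => top_i; rewrite (top_pair_uniq _ _ top_i top_t).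
move/existsPn => ntops; apply: eq_bigr => i _.
have ntop_lt j : (j < n.+2)%N -> ~~ top_pair w j.
  by move=> lt_jn; exact: (ntops (Ordinal lt_jn)).
by have lt_in := ltn_ord i; rewrite !up_swap_top ?ntop_lt // leqW.
Qed.

(* For n > 0, c tells whether the last step is an ascent. *)
Definition SgnAltrun n (c : bool) : R :=
  \sum_(w in evenly_signed n | up w n.-1 == c)
     (-1) ^+ w.1 * wt p q (up w) n.-1.

Lemma SgnAltrun_top_pair n c :
  SgnAltrun n.+2 c =
    \sum_(w | [&& w \in evenly_signed n.+2, up w n.+1 == c & top_pair w n.+1])
       (-1) ^+ w.1 * wt p q (up w) n.+1.
Proof.
rewrite /SgnAltrun (bigID (fun w => top_pair w n.+1)) /=.
under eq_bigl => w do rewrite -andbA.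
rewrite [X in _ + X](_ : _ = 0) ?addr0 //.
(* Among words without a final top pair, the exchange matches even underlying permutations with odd
   ones of equal weight and opposite sign. *)
rewrite (bigID (fun w : signed_perm n.+2 => odd_perm w.1)) /=.
rewrite [X in _ + X](reindex_inj (inv_inj (@swap_topK n))) /=.
rewrite [X in _ + X](eq_bigl (fun w => (w \in evenly_signed n.+2) &&
  (up w n.+1 == c) && ~~ top_pair w n.+1 && odd_perm w.1)) => [|w]; last first.
  rewrite swap_top_evenly_signed top_pair_swap odd_swap_top negbK.
  case: (boolP (top_pair w n.+1)) => [_|ntop]; first by rewrite !andbF.
  by rewrite up_swap_top.
rewrite -big_split big1 //= => w /andP[/andP[_ ntop] odd_w].
by rewrite wt_swap_top // odd_swap_top odd_w mulN1r mul1r addNr.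
Qed.

End Weights.

(** * Words ending in a top pair, as extensions of shorter words *)

Lemma letter_penult n (w : signed_perm n.+2) :
  letter w n.+1 = (-1) ^+ w.2 (penult n) * (w.1 (penult n)).+1%:Z.
Proof. by have := letterS w (penult n); rewrite val_penult. Qed.

(* Appends the letters n.+1, n.+2, negated when b holds. *)
Definition ext n (w : signed_perm n) (b : bool) : signed_perm n.+2 :=
  (lift_perm ord_max ord_max (lift_perm ord_max ord_max w.1),
   [ffun i => if unlift ord_max i is Some j then
                if unlift ord_max j is Some k then w.2 k else b
              else b]).

Lemma letter_ext n (w : signed_perm n) b i : (i <= n)%N ->
  letter (ext w b) i = letter w i.
Proof.
case: i => [|i] // lt_in; set k := Ordinal lt_in.
have kE : lift ord_max (lift ord_max k) = i :> nat by rewrite !lift_max.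
rewrite -[in LHS]kE letterS (letterS w k) ffunE !liftK !lift_perm_lift.
by rewrite !lift_max.
Qed.

Lemma letter_ext1 n (w : signed_perm n) b :
  letter (ext w b) n.+1 = (-1) ^+ b * n.+1%:Z.
Proof.
rewrite letter_penult ffunE liftK unlift_none.
by rewrite lift_perm_lift lift_perm_id val_penult.
Qed.

Lemma letter_ext2 n (w : signed_perm n) b :
  letter (ext w b) n.+2 = (-1) ^+ b * n.+2%:Z.
Proof.
rewrite (letterS _ ord_max) ffunE unlift_none /=.
by rewrite lift_perm_id.
Qed.

Lemma ext_inj n (w w' : signed_perm n) b b' :
  ext w b = ext w' b' -> w = w' /\ b = b'.
Proof.
move=> eq_ext; split.
  apply: letter_inj => i.
  by rewrite -(letter_ext w b (ltn_ord i)) eq_ext letter_ext.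
have := letter_ext1 w b; rewrite eq_ext letter_ext1.
by case: b b' {eq_ext} => [] [] //=; lia.
Qed.

(** Deleting [i] and its image from [s] and renumbering the rest in order gives [t]. *)
Lemma lift_perm_onto n (s : 'S_n.+1) i : exists t, s = lift_perm i (s i) t.
Proof.
have lift_s k : exists l, s (lift i k) == lift (s i) l.
  have := neq_lift i k; rewrite -(inj_eq (@perm_inj _ s)).
  by move=> /unlift_some[l -> _]; exists l.
pose f k := xchoose (lift_s k).
have fE k : lift (s i) (f k) = s (lift i k).
  exact/esym/eqP/(xchooseP (lift_s k)).
have f_inj : injective f.
  by move=> k l /(congr1 (lift (s i))); rewrite !fE => /perm_inj/lift_inj.
exists (perm f_inj); apply/permP => k.
case: (unliftP i k) => [l ->|->]; last by rewrite lift_perm_id.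
by rewrite lift_perm_lift permE fE.
Qed.

Lemma top_pair_last n (w : signed_perm n.+2) :
  top_pair w n.+1 =
    [&& (n <= w.1 (penult n))%N, (n <= w.1 ord_max)%N
      & w.2 (penult n) == w.2 ord_max].
Proof.
rewrite /top_pair (absz_letterS w ord_max) (letterS_lt0 w ord_max).
have := absz_letterS w (penult n); have := letterS_lt0 w (penult n).
by rewrite val_penult => -> ->.
Qed.

Lemma top_pair_ext n (w : signed_perm n) b : top_pair (ext w b) n.+1.
Proof.
rewrite top_pair_last /= !ffunE liftK !unlift_none eqxx andbT.
by rewrite lift_perm_lift !lift_perm_id val_penult /= leqnn leqnSn.
Qed.

(** The last position is deleted twice: once the largest value is gone, the top pair forces the next
    one to be the largest that remains. *)
Lemma top_pair_onto n (w : signed_perm n.+2) :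
  top_pair w n.+1 -> w.1 ord_max = ord_max -> exists w' b, w = ext w' b.
Proof.
rewrite top_pair_last; case: w => s e /= /and3P[le_n _ /eqP eq_e] s_max.
have [t sE] := lift_perm_onto s ord_max; rewrite s_max in sE.
have t_max : t ord_max = ord_max.
  move: le_n; rewrite sE lift_perm_lift lift_max => le_n.
  by apply/val_inj/eqP; rewrite /= eqn_leq le_n -ltnS ltn_ord.
have [t' tE] := lift_perm_onto t ord_max; rewrite t_max in tE.
exists (t', [ffun k => e (lift ord_max (lift ord_max k))]), (e ord_max).
rewrite /ext /= -tE -sE; congr pair; apply/ffunP => i; rewrite ffunE.
case: unliftP => [j ->|-> //]; case: unliftP => [k ->|-> //].
by rewrite ffunE.
Qed.

Lemma swap_top_max n (w : signed_perm n.+2) : top_pair w n.+1 ->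
  ((swap_top w).1 ord_max != ord_max) = (w.1 ord_max == ord_max).
Proof.
rewrite top_pair_last /= permM => /and3P[_ le_n _].
case: tpermP => [->|->|ne_p ne_m].
- by rewrite eqxx (negPf (penult_neq_max n)).
- by rewrite eqxx penult_neq_max.
- move: ne_p ne_m => /eqP + /eqP.
  rewrite -!val_eqE [val (penult n)]val_penult /=.
  by have := ltn_ord (w.1 ord_max); lia.
Qed.

(** In each orbit of the exchange exactly one word has its largest absolute value last, and that
    word is an extension. *)
Lemma sum_top_pair n (V : nmodType) (F : signed_perm n.+2 -> V) :
  \sum_(w | top_pair w n.+1) F w =
    \sum_(w : signed_perm n) \sum_b (F (ext w b) + F (swap_top (ext w b))).
Proof.
rewrite (bigID (fun w : signed_perm n.+2 => w.1 ord_max == ord_max)) /=.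
rewrite [X in _ + X](reindex_inj (inv_inj (@swap_topK n))) /=.
rewrite [X in _ + X](eq_bigl (fun w : signed_perm n.+2 =>
  top_pair w n.+1 && (w.1 ord_max == ord_max))) => [|w]; last first.
  rewrite top_pair_swap; case: (boolP (top_pair _ _)) => //= top_w.
  exact: swap_top_max.
rewrite -big_split /= pair_bigA /=.
pose h (wb : signed_perm n * bool) := ext wb.1 wb.2.
rewrite (eq_bigl (mem (h @: setT))) => [|w].
  rewrite big_imset /= => [|[w b] [w' b'] _ _ /ext_inj[/= -> ->] //].
  by apply: eq_bigl => wb; rewrite inE.
apply/andP/imsetP => [[top_w /eqP w_max] | [[w' b] _ ->]].
  by have [w' [b ->]] := top_pair_onto top_w w_max; exists (w', b).
by rewrite /h top_pair_ext lift_perm_id.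
Qed.

(** The two appended signs are equal and cancel modulo 2. *)
Lemma ext_evenly_signed n (w : signed_perm n) b :
  (ext w b \in evenly_signed _) = (w \in evenly_signed _).
Proof.
have ord_lift m (i : 'I_m) : widen_ord (leqnSn m) i = lift ord_max i.
  by apply: val_inj; rewrite [RHS](lift_max i).
rewrite !evenly_signedE !big_ord_recr /= !ffunE.
rewrite [widen_ord _ _]ord_lift liftK !unlift_none addbK.
by under eq_bigr => i _ do rewrite ffunE !ord_lift !liftK.
Qed.

Lemma odd_ext n (w : signed_perm n) b : (ext w b).1 = w.1 :> bool.
Proof. by rewrite !odd_lift_perm !addbb. Qed.

Lemma up_ext n (w : signed_perm n) b i : (i < n)%N ->
  up (ext w b) i = up w i.
Proof. by move=> lt_in; rewrite /up !letter_ext // ltnW. Qed.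

Lemma up_ext1 n (w : signed_perm n) b : up (ext w b) n = ~~ b.
Proof.
rewrite /up letter_ext // letter_ext1; have := absz_letter_le w n.
by case: b => /=; rewrite ?expr1 ?expr0; lia.
Qed.

Lemma up_ext2 n (w : signed_perm n) b : up (ext w b) n.+1 = ~~ b.
Proof.
by rewrite /up letter_ext1 letter_ext2; case: b; rewrite /= ?expr1 ?expr0; lia.
Qed.

(** * Recurrence and closed forms *)

Section Recurrence.

Variables (R : comNzRingType) (p q : R).

Lemma eq_wt (u v : nat -> bool) m :
  (forall i, (i <= m)%N -> u i = v i) -> wt p q u m = wt p q v m.
Proof.
move=> uv; apply: eq_bigr => i _; have lt_im := ltn_ord i.
by rewrite !uv // ltnW.
Qed.

Lemma wtS u m : wt p q u m.+1 = wt p q u m * turn p q (u m) (u m.+1).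
Proof. by rewrite /wt big_ord_recr. Qed.

(** The last two steps of [ext w b] are both [~~ b]; exchanging turns the last one into [b]. So last
    step [c] arises from [ext w (~~ c)], with trivial last turn, and from the exchanged [ext w c],
    with opposite sign and a final valley or peak. *)
Lemma SgnAltrun_ext n c :
  SgnAltrun p q n.+2 c = \sum_(w in evenly_signed n) (-1) ^+ w.1 *
    (wt p q (up (ext w (~~ c))) n -
      (if c then q else p) * wt p q (up (ext w c)) n).
Proof.
rewrite SgnAltrun_top_pair.
under eq_bigl => w do rewrite andbA andbC.
rewrite big_mkcondr sum_top_pair [RHS]big_mkcond; apply: eq_bigr => w _.
rewrite big_bool !swap_top_evenly_signed !odd_swap_top.
rewrite !ext_evenly_signed !odd_ext.
case: (w \in evenly_signed n) => /=; last by rewrite !addr0.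
have top_w b := top_pair_ext w b.
(* The only top pair is at the end, so the exchange alters no earlier step. *)
have swE b i : (i <= n)%N -> up (swap_top (ext w b)) i = up (ext w b) i.
  move=> le_in; have lt_in : (i < n.+2)%N by lia.
  apply: up_swap_top => //; apply/negP => top_i.
  by have := top_pair_uniq lt_in (ltnSn _) top_i (top_w b); lia.
have wt_swE b : wt p q (up (swap_top (ext w b))) n = wt p q (up (ext w b)) n.
  by apply: eq_wt => i; exact: swE.
rewrite !wtS !wt_swE !(swE _ n (leqnn n)) !up_swap_top_pair //.
rewrite !up_ext1 !up_ext2.
case: c; case: (w.1 : bool); rewrite /= /turn /= ?expr0 ?expr1; ring.
Qed.

(** If the last step of [w] is [c], the bracket in [SgnAltrun_ext] is [1 - p * q] times the weight
    of [w]; otherwise its two terms cancel. This needs [w] to have a last step, hence [n.+1]. *)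
Lemma SgnAltrunS2 n c :
  SgnAltrun p q n.+3 c = (1 - p * q) * SgnAltrun p q n.+1 c.
Proof.
rewrite SgnAltrun_ext /SgnAltrun big_distrr big_mkcondr /=.
apply: eq_bigr => w _.
have wtE b : wt p q (up (ext w b)) n.+1 =
    wt p q (up w) n * turn p q (up w n) (~~ b).
  rewrite wtS up_ext // up_ext1; congr (_ * _).
  by apply: eq_wt => i le_in; rewrite up_ext.
rewrite !wtE negbK; set s := (-1) ^+ _; set x := wt _ _ _ _.
by case: (up w n) c => [] []; rewrite /turn /=; ring.
Qed.

Lemma SgnAltrun2 c : SgnAltrun p q 2 c = 1 - (if c then q else p).
Proof.
rewrite SgnAltrun_ext (big_pred1 (1%g, [ffun=> false])) => [|w].
  by rewrite odd_perm1 /wt !big_ord0 mul1r mulr1.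
rewrite evenly_signedE big_ord0; apply/esym/eqP/letter_inj.
by case.
Qed.

(** The only evenly signed word is 1, whose single step, from letter 0, is an ascent. This is why
    the descent sums vanish in odd length. *)
Lemma SgnAltrun1 c : SgnAltrun p q 1 c = c%:R.
Proof.
rewrite /SgnAltrun big_mkcondr (big_pred1 (1%g, [ffun=> false])) => [|w].
  rewrite odd_perm1 /wt !big_ord0 mulr1 /up (letterS _ ord0) ffunE perm1 /=.
  by rewrite expr0 mul1r; case: c.
rewrite evenly_signedE big_ord1.
apply/idP/eqP => [nw|->]; last by rewrite ffunE.
apply: letter_inj => i; rewrite !letterS (ord1 i) (negPf nw) ffunE perm1.
by rewrite (ord1 (w.1 ord0)).
Qed.

Lemma SgnAltrun_odd k c :
  SgnAltrun p q (2 * k + 1) c = c%:R * (1 - p * q) ^+ k.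
Proof.
elim: k => [|k IHk]; first by rewrite SgnAltrun1 mulr1.
rewrite (_ : 2 * k.+1 + 1 = (2 * k).+3)%N; last lia.
by rewrite SgnAltrunS2 -[(2 * k).+1]addn1 IHk exprS; ring.
Qed.

Lemma SgnAltrun_even k c :
  SgnAltrun p q (2 * k.+1) c = (1 - (if c then q else p)) * (1 - p * q) ^+ k.
Proof.
elim: k => [|k IHk]; first by rewrite SgnAltrun2 mulr1.
rewrite (_ : 2 * k.+2 = (2 * k).+4)%N; last lia.
rewrite SgnAltrunS2 (_ : (2 * k).+2 = 2 * k.+1)%N; last lia.
by rewrite IHk exprS; ring.
Qed.

Lemma SgnDAltrun_aE n : SgnDAltrun_a n.+1 p q = SgnAltrun p q n.+1 true.
Proof.
rewrite /SgnAltrun; apply: eq_big => [w|w _]; last exact: weightE.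
by rewrite inE eqb_id.
Qed.

Lemma SgnDAltrun_dE n : SgnDAltrun_d n.+1 p q = SgnAltrun p q n.+1 false.
Proof.
rewrite /SgnAltrun; apply: eq_big => [w|w _]; last exact: weightE.
by rewrite inE down_up // eqbF_neg.
Qed.

End Recurrence.

Theorem theorem48 (R : comNzRingType) (p q : R) (n : nat) (hn : (0 < n)%N) :
  [/\ forall k : nat, n = (2 * k)%N ->
        SgnDAltrun_a n p q = (1 - q) * (1 - p * q) ^+ (k - 1),
      forall k : nat, n = (2 * k + 1)%N ->
        SgnDAltrun_a n p q = (1 - p * q) ^+ k,
      forall k : nat, n = (2 * k)%N ->
        SgnDAltrun_d n p q = (1 - p) * (1 - p * q) ^+ (k - 1)
    & odd n -> SgnDAltrun_d n p q = 0].
Proof.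
case: n hn => // n _; rewrite SgnDAltrun_aE SgnDAltrun_dE.
split=> [[|k] // ->|k ->|[|k] // ->|odd_n].
- by rewrite SgnAltrun_even subn1.
- by rewrite SgnAltrun_odd mul1r.
- by rewrite SgnAltrun_even subn1.
rewrite -(odd_double_half n.+1) odd_n addnC -mul2n.
by rewrite SgnAltrun_odd mul0r.
Qed.
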